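(* Let $G$ be a group with an involution $\alpha$, let $\mathcal{H}$ be a Hilbert space, let $\varphi:G\to L(\mathcal{H})$ be an $\alpha$-completely positive map, and let $(\pi_\varphi,(\mathcal{H}_\varphi,\mathcal{J}_\varphi),V_\varphi)$ be the minimal Stinespring construction associated to $\varphi$. Then the map $\psi\mapsto\Delta_\varphi(\psi)$ is an affine bijective map from $\{\psi\in\alpha\text{-}CP(G,\mathcal{H}):\psi\leq_u\varphi\}$ onto $\{T\in\pi_\varphi(G)'\subseteq L(\mathcal{H}_\varphi): T\mathcal{J}_\varphi=\mathcal{J}_\varphi T,\ T\geq 0\}$ which preserves the pre-order relation, i.e. if $\psi_1\leq_u\psi_2\leq_u\varphi$ then there is $\lambda>0$ with $\Delta_\varphi(\psi_1)\leq\lambda\Delta_\varphi(\psi_2)$.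
   Context: An involution of a group $G$ (with identity $e$) is a map $\alpha:G\to G$ (assumed continuous if $G$ is a topological group) with $\alpha^{2}=\mathrm{id}_G$, $\alpha(e)=e$ and $\alpha(g^{-1})=\alpha(g)^{-1}$ for all $g\in G$; it is not required to be a homomorphism. $L(\mathcal{H})$ denotes the bounded linear operators on a Hilbert space $\mathcal{H}$. An $n\times n$ matrix with entries in $L(\mathcal{H})$ is regarded as an operator on $\mathcal{H}^n$; positivity and the order $\leq$ between such matrices refer to this. A map $\varphi:G\to L(\mathcal{H})$ is $\alpha$-completely positive if: (1) $\varphi(\alpha(g_1)\alpha(g_2))=\varphi(\alpha(g_1g_2))=\varphi(g_1g_2)$ for all $g_1,g_2\in G$; (2) for all $n$ and $g_1,\dots,g_n\in G$, the matrix $[\varphi(\alpha(g_i)^{-1}g_j)]_{i,j=1}^n$ is positive; (3) there is $K>0$ such that $[\varphi(g_i)^{*}\varphi(g_j)]_{i,j=1}^n\leq K[\varphi(\alpha(g_i)^{-1}g_j)]_{i,j=1}^n$ for all $n$ and $g_1,\dots,g_n\in G$; (4) for every $g\in G$ there is $M(g)>0$ such that $[\varphi(\alpha(gg_i)^{-1}gg_j)]_{i,j=1}^n\leq M(g)[\varphi(\alpha(g_i)^{-1}g_j)]_{i,j=1}^n$ for all $n$ and $g_1,\dots,g_n\in G$. $\alpha\text{-}CP(G,\mathcal{H})$ is the set of all $\alpha$-completely positive maps $G\to L(\mathcal{H})$. For such maps, $\psi\leq\varphi$ means that $\varphi-\psi$ is $\alpha$-completely positive, and $\psi\leq_u\varphi$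 ($\psi$ is uniformly dominated by $\varphi$) means that $\psi\leq\lambda\varphi$ for some $\lambda>0$. A Krein space is a pair $(\mathcal{K},\mathcal{J})$ of a Hilbert space $\mathcal{K}$ and a bounded linear operator $\mathcal{J}$ on $\mathcal{K}$ with $\mathcal{J}=\mathcal{J}^{*}=\mathcal{J}^{-1}$. A $\mathcal{J}$-unitary representation of $G$ on $(\mathcal{K},\mathcal{J})$ is a multiplicative map $\pi:G\to L(\mathcal{K})$ with $\pi(e)=\mathrm{id}_{\mathcal{K}}$ and $\pi(g^{-1})=\mathcal{J}\pi(g)^{*}\mathcal{J}$ for all $g\in G$. $\pi(G)'$ is the commutant of $\pi(G)$ in $L(\mathcal{K})$. The minimal Stinespring construction associated to an $\alpha$-completely positive map $\varphi$ is a triple $(\pi_\varphi,(\mathcal{H}_\varphi,\mathcal{J}_\varphi),V_\varphi)$, where $(\mathcal{H}_\varphi,\mathcal{J}_\varphi)$ is a Krein space, $\pi_\varphi$ is a $\mathcal{J}_\varphi$-unitary representation of $G$ on it and $V_\varphi:\mathcal{H}\to\mathcal{H}_\varphi$ is bounded linear, such that $\varphi(g)=V_\varphi^{*}\pi_\varphi(g)V_\varphi$ and $\mathcal{J}_\varphi\pi_\varphi(g)V_\varphi=\pi_\varphi(\alpha(g))V_\varphi$ for all $g\in G$, and the closed linear span of $\{\pi_\varphi(g)V_\varphi\xi: g\in G,\xi\in\mathcal{H}\}$ is $\mathcal{H}_\varphi$. It exists and is unique up to unitary equivalence. For $T\in\pi_\varphi(G)'$ with $T\geq0$ and $T\mathcal{J}_\varphi=\mathcal{J}_\varphi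 T$, let $\varphi_T(g)=V_\varphi^{*}T\pi_\varphi(g)V_\varphi$. If $\psi\leq_u\varphi$, the Radon-Nikodym derivative $\Delta_\varphi(\psi)$ of $\psi$ with respect to $\varphi$ is the operator $T\in\pi_\varphi(G)'$ with $T\geq0$, $T\mathcal{J}_\varphi=\mathcal{J}_\varphi T$ and $\psi=\varphi_T$ (there is exactly one such operator). *)

(* Defs.v *)
From HB Require Import structures.
From mathcomp Require Import all_boot all_order all_algebra sesquilinear.
From mathcomp Require Import all_classical all_reals all_analysis.
From mathcomp Require Import complex.

Set Implicit Arguments.
Unset Strict Implicit.
Unset Printing Implicit Defensive.

Import Order.TTheory GRing.Theory Num.Theory.
Import numFieldNormedType.Exports.

Local Open Scope classical_set_scope.
Local Open Scope ring_scope.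

(* Scalars are the complex numbers R[i] over R : realType.  In the partial
   order of R[i], 0 <= z holds iff z is real and nonnegative; hence a positive
   real constant is given as some z : R[i] with 0 < z, and an inequality
   0 <= hdot _ _ includes the claim that the inner product is real. *)

(* Inner products are linear in the first argument. *)
HB.mixin Record CompleteNormedModule_isHilbert (R : realType) H
    of CompleteNormedModule R[i] H := {
  hdot : {dot H for (@Num.conj R[i])} ;
  hdotxx : forall x : H, hdot x x = `|x| ^+ 2
}.

#[short(type="hilbertType")]
HB.structure Definition Hilbert (R : realType) :=
  {H of CompleteNormedModule_isHilbert R H & CompleteNormedModule R[i] H}.

Section BoundedOperators.
Context {R : realType} {H K : hilbertType R}.

Definition is_bounded_operator : {pred H -> K} :=
  fun f => `[< linear f /\
    exists2 M : R[i], 0 <= M & forall x, `|f x| <= M * `|x| >].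

Lemma bounded_operator_submod : submod_closed is_bounded_operator.
Proof.
split=> [|a f g /asboolP[lf [M M0 fM]] /asboolP[lg [N N0 gN]]]; apply/asboolP.
  split=> [b x y|]; first by rewrite /= scaler0 addr0.
  by exists 0 => // x; rewrite normr0 mul0r.
split=> [b x y|].
  have E z : (a *: f + g) z = a *: f z + g z by [].
  rewrite !E lf lg !scalerDr !scalerA [b * a]mulrC -!addrA; congr (_ + _).
  by rewrite addrCA.
exists (`|a| * M + N) => [|x]; first by rewrite addr_ge0 ?mulr_ge0.
rewrite (le_trans (ler_normD _ _))// mulrDl lerD//.
by rewrite normrZ -mulrA ler_wpM2l.
Qed.

HB.instance Definition _ :=
  GRing.isSubmodClosed.Build R[i] (H -> K) is_bounded_operator
    bounded_operator_submod.

Record operator := Operator {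
  opval :> H -> K ;
  opvalP : opval \in is_bounded_operator }.

HB.instance Definition _ := [isSub for opval].
HB.instance Definition _ := [Choice of operator by <:].
HB.instance Definition _ := [SubChoice_isSubLmodule of operator by <:].

Lemma operator_linear (A : operator) : linear A.
Proof. by have /asboolP[] := opvalP A. Qed.

HB.instance Definition _ (A : operator) :=
  GRing.isLinear.Build R[i] H K *:%R A (operator_linear A).

Lemma operator_bounded (A : operator) :
  exists2 M : R[i], 0 <= M & forall x, `|A x| <= M * `|x|.
Proof. by have /asboolP[] := opvalP A. Qed.

End BoundedOperators.
Arguments operator {R} H K.

Notation "''L' ( H , K )" := (operator H K)
  (at level 8, format "''L' ( H ,  K )") : type_scope.
Notation "''L' ( H )" := (operator H H)
  (at level 8, format "''L' ( H )") : type_scope.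

Section OperatorAlgebra.
Context {R : realType}.
Implicit Types H K L : hilbertType R.

Lemma comp_operatorP H K L (A : 'L(K, L)) (B : 'L(H, K)) :
  A \o B \in is_bounded_operator.
Proof.
apply/asboolP; split=> [a x y|]; first by rewrite /= !linearP.
have [M M0 AM] := operator_bounded A; have [N N0 BN] := operator_bounded B.
exists (M * N) => [|x]; first exact: mulr_ge0.
by rewrite (le_trans (AM _))// -mulrA ler_wpM2l.
Qed.

Definition opcomp H K L (A : 'L(K, L)) (B : 'L(H, K)) : 'L(H, L) :=
  Operator (comp_operatorP A B).

Lemma id_operatorP H : (id : H -> H) \in is_bounded_operator.
Proof. by apply/asboolP; split=> //; exists 1 => // x; rewrite mul1r. Qed.

Definition opid H : 'L(H) := Operator (id_operatorP H).

(* The set below is a singleton, by the Riesz representation theorem. *)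
Definition adjoint H K (A : 'L(H, K)) : 'L(K, H) :=
  xget 0 [set B : 'L(K, H) | forall x y, hdot (A x) y = hdot x (B y)].

Definition op_ge0 H (A : 'L(H)) : Prop := forall x, 0 <= hdot (A x) x.

Definition op_le H (A B : 'L(H)) : Prop := op_ge0 (B - A).

(* The Hilbert space H^n consists of the functions 'I_n -> H with the inner
   product hdotn; opmx_app is the action on it of a matrix of operators. *)
Definition hdotn H n (x y : 'I_n -> H) : R[i] := \sum_(i < n) hdot (x i) (y i).

Definition opmx_app H n (A : 'M['L(H)]_n) (x : 'I_n -> H) : 'I_n -> H :=
  fun i => \sum_(j < n) A i j (x j).

Definition opmx_ge0 H n (A : 'M['L(H)]_n) : Prop :=
  forall x : 'I_n -> H, 0 <= hdotn (opmx_app A x) x.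

Definition opmx_le H n (A B : 'M['L(H)]_n) : Prop := opmx_ge0 (B - A).

Definition opmx_scale H n (c : R[i]) (A : 'M['L(H)]_n) : 'M['L(H)]_n :=
  map_mx (fun T => c *: T) A.

Definition linear_span H (S : set H) : set H :=
  [set x | exists n (c : 'I_n -> R[i]) (s : 'I_n -> H),
     (forall i, S (s i)) /\ x = \sum_(i < n) c i *: s i].

End OperatorAlgebra.
Arguments opid {R} H.

Notation "A *o B" := (opcomp A B) (at level 40, left associativity).

(* An affine map on a convex set; the first conjunct of the conclusion says
   that the set A is convex. *)
Definition affine_on (R : realType) (U W : lmodType R[i]) (A : set U)
    (f : U -> W) : Prop :=
  forall (t : R[i]) (x y : U), 0 <= t <= 1 -> A x -> A y ->
    A (t *: x + (1 - t) *: y) /\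
    f (t *: x + (1 - t) *: y) = t *: f x + (1 - t) *: f y.

Section AlphaCP.
Context {R : realType} {G : groupType}.
Implicit Types (H K : hilbertType R) (alpha : G -> G).

Definition involution alpha : Prop :=
  [/\ involutive alpha, alpha 1%g = 1%g &
      forall g, alpha (g^-1)%g = ((alpha g)^-1)%g].

Definition acp_mx H alpha (phi : G -> 'L(H)) n (g : 'I_n -> G) : 'M['L(H)]_n :=
  \matrix_(i, j) phi ((alpha (g i))^-1 * g j)%g.

Definition alphaCP H alpha : set (G -> 'L(H)) :=
  [set phi |
    [/\ forall g1 g2, phi (alpha g1 * alpha g2)%g = phi (alpha (g1 * g2)%g)
                   /\ phi (alpha (g1 * g2)%g) = phi (g1 * g2)%g,
        forall n (g : 'I_n -> G), opmx_ge0 (acp_mx alpha phi g),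
        exists2 k : R[i], 0 < k & forall n (g : 'I_n -> G),
          opmx_le (\matrix_(i, j) (adjoint (phi (g i)) *o phi (g j)))
                  (opmx_scale k (acp_mx alpha phi g)) &
        forall h : G, exists2 m : R[i], 0 < m & forall n (g : 'I_n -> G),
          opmx_le (acp_mx alpha phi (fun i => h * g i)%g)
                  (opmx_scale m (acp_mx alpha phi g))]].

Definition acp_le H alpha (psi phi : G -> 'L(H)) : Prop :=
  alphaCP alpha (phi - psi).

Definition acp_udom H alpha (psi phi : G -> 'L(H)) : Prop :=
  exists2 lambda : R[i], 0 < lambda & acp_le alpha psi (lambda *: phi).

Definition krein_symmetry K (J : 'L(K)) : Prop :=
  adjoint J = J /\ J *o J = opid K.

Definition unitary_rep K (J : 'L(K)) (pi : G -> 'L(K)) : Prop :=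
  [/\ forall g h, pi (g * h)%g = pi g *o pi h,
      pi 1%g = opid K &
      forall g, pi (g^-1)%g = J *o adjoint (pi g) *o J].

Definition minimal_stinespring H K alpha (phi : G -> 'L(H))
    (pi : G -> 'L(K)) (J : 'L(K)) (V : 'L(H, K)) : Prop :=
  [/\ krein_symmetry J,
      unitary_rep J pi,
      forall g, phi g = adjoint V *o pi g *o V,
      forall g, J *o pi g *o V = pi (alpha g) *o V &
      closure (linear_span [set x | exists g xi, x = pi g (V xi)]) = setT].

Definition commutant K (pi : G -> 'L(K)) : set 'L(K) :=
  [set T | forall g, T *o pi g = pi g *o T].

Definition compress H K (pi : G -> 'L(K)) (V : 'L(H, K)) (T : 'L(K)) :
    G -> 'L(H) :=
  fun g => adjoint V *o T *o pi g *o V.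

Definition RN_target K (pi : G -> 'L(K)) (J : 'L(K)) : set 'L(K) :=
  [set T | [/\ commutant pi T, T *o J = J *o T & op_ge0 T]].

(* The Radon-Nikodym derivative of psi: the operator T in RN_target with
   psi = compress T.  If none existed, the value would be 0. *)
Definition RN_derivative H K (pi : G -> 'L(K)) (J : 'L(K)) (V : 'L(H, K))
    (psi : G -> 'L(H)) : 'L(K) :=
  xget 0 [set T | RN_target pi J T /\ psi = compress pi V T].

End AlphaCP.

(* Main.v *)
Require Import Defs.
From HB Require Import structures.
From mathcomp Require Import all_boot all_order all_algebra.
From mathcomp Require Import all_classical all_reals all_analysis.
From mathcomp Require Import complex.
From mathcomp Require Import ring.

Set Implicit Arguments.
Unset Strict Implicit.
Unset Printing Implicit Defensive.

Import Order.TTheory GRing.Theory Num.Theory.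
Import numFieldNormedType.Exports.

Local Open Scope classical_set_scope.
Local Open Scope ring_scope.

(** The whole theorem rests on one identity.  For T in the commutant of pi(G),
    the relations defining the minimal Stinespring construction give
      <phi_T(alpha(g)^-1 h) x, y> = <T pi(h)Vx, pi(g)Vy>
    ([compress_gram]).  So the matrices [phi_T(alpha(g_i)^-1 g_j)] that occur in
    the definition of alpha-complete positivity are exactly the quadratic form
    of T evaluated on the vectors sum_j pi(g_j)Vx_j, and these vectors are dense
    by minimality.

    - Uniqueness: T is determined by its form on a dense set of vectors, hence
      by phi_T ([compress_inj]).
    - If T is positive and commutes with pi(G) and J, then phi_T is
      alpha-completely positive ([compress_alphaCP]): positivity is immediate,
      the bound on [phi_T(g_i)^* phi_T(g_j)] says |V^* T u|^2 <= K <Tu, u>, and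
      translation by h amounts to <T pi(h)u, pi(h)u> <= m <Tu, u>, which holds
      because T commutes with pi(h) and its adjoint ([op_ge0_conj]).  As
      lambda - T is again such an operator for large lambda, phi_T is uniformly
      dominated by phi ([compress_udom]).
    - Existence: if psi is positive and psi <= lambda phi, the form attached to
      psi on formal sums of pairs (g, x) is bounded, by Cauchy-Schwarz, by
      lambda times the norms of the two vectors represented, so it descends to
      a bounded form on a dense subspace and is given by an operator T
      ([RN_exists]); commutation of T with pi(G) and J is read off from the
      values of psi.
    - The correspondence T |-> phi_T is affine, and an inequality between forms
      on the dense subspace passes to the derivatives by continuity.

    Adjoints and T both come from the Riesz representation theorem, proved here
    for bounded linear relations rather than for functionals
    ([riesz_relation]): it then applies to functionals on a dense
    subspace that are given on non-unique representatives, with neither a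
    well-definedness check nor an extension by continuity. *)

(** * Scalar inequalities *)

Section Scalars.
Variable C : numClosedFieldType.

(** Positivity at a = 1 and a = 'i makes both b + b' and 'i * (b - b') real. *)
Lemma hermitian_coef (p q b b' : C) : 0 <= p ->
  (forall a : C, 0 <= a * a^* * p + a * b + a^* * b' + q) -> b' = b^*.
Proof.
move=> p0 pos.
have q0 : 0 <= q by have := pos 0; rewrite conjC0 !mul0r !add0r.
have realP (z : C) : 0 <= p + z + q -> z^* = z.
  move=> h; apply/CrealP.
  have -> : z = (p + z + q) - p - q by ring.
  by rewrite !rpredB ?ger0_real.
have e1 : (b + b')^* = b + b'.
  by apply: realP; have := pos 1; rewrite conjC1 !mul1r !addrA.
have e2 : ('i * (b - b'))^* = 'i * (b - b').
  apply: realP; have := pos 'i.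
  by rewrite (conjCi C) mulrN -expr2 sqrCi opprK mul1r mulNr mulrBr !addrA.
rewrite rmorphM rmorphB/= conjCi mulNr -mulrN in e2.
have {e2}/(mulfI (neq0Ci C)) e2 := e2.
rewrite rmorphD/= in e1.
have e : b^* + b^* = b' + b'.
  have -> : b^* + b^* = (b^* + b'^*) + - (- (b^* - b'^*)) by ring.
  by rewrite e2 e1; ring.
have two0 : 2 != 0 :> C by rewrite pnatr_eq0.
by apply: (mulfI two0); rewrite !mulr2n !mulrDl !mul1r e.
Qed.

(** The argument behind every Cauchy-Schwarz inequality below: evaluate the
    nonnegative expression at its minimum a = - b^* / p.  It is stated for
    coefficients, not for vectors, so that it also serves for forms on formal
    sums, which are not a vector space. *)
Lemma hermitian_discriminant (p q b b' : C) : 0 <= p ->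
  (forall a : C, 0 <= a * a^* * p + a * b + a^* * b' + q) ->
  `|b| ^+ 2 <= p * q.
Proof.
move=> p0 pos; have eb := hermitian_coef p0 pos; rewrite {b'}eb in pos.
have q0 : 0 <= q by have := pos 0; rewrite conjC0 !mul0r !add0r.
have step (t : C) : 0 <= t ->
    0 <= t ^+ 2 * `|b| ^+ 2 * p - 2 * t * `|b| ^+ 2 + q.
  move=> t0; have := pos (- t * b^*).
  rewrite rmorphM rmorphN/= conjCK (geC0_conj t0) !normCK.
  by congr (0 <= _); ring.
move: p0; rewrite le_eqVlt => /predU1P[p0|p0]; last first.
  have := step p^-1; rewrite invr_ge0 => /(_ (ltW p0)).
  rewrite -(pmulr_rge0 _ p0).
  have -> : p * (p^-1 ^+ 2 * `|b| ^+ 2 * p - 2 * p^-1 * `|b| ^+ 2 + q) =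
            p * q - `|b| ^+ 2 by field; rewrite gt_eqF.
  by rewrite subr_ge0.
rewrite -p0 mul0r in step *.
(* For p = 0 the expression is affine in t, so b must vanish. *)
have [->|b0] := eqVneq b 0; first by rewrite normr0 expr0n.
have n0 : 0 < `|b| ^+ 2 by rewrite exprn_gt0// normr_gt0.
have := step ((q + 1) / (2 * `|b| ^+ 2)).
rewrite divr_ge0 ?(addr_ge0 q0) ?mulr_ge0 ?(ltW n0)// => /(_ isT).
rewrite mulr0.
have -> : 0 - 2 * ((q + 1) / (2 * `|b| ^+ 2)) * `|b| ^+ 2 + q = - 1.
  by field; rewrite normr_eq0 b0.
by rewrite ler0N1.
Qed.

End Scalars.

Section Complex.
Variable R : realType.
Implicit Types (x c e z : R[i]).

Lemma le_all_eps_eq0 x c : 0 <= x -> 0 <= c ->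
  (forall e, 0 < e -> x <= c * e) -> x = 0.
Proof.
move=> x0 c0 small; apply/eqP; rewrite eq_le x0 andbT.
have [->//|xN0] := eqVneq x 0.
have xgt0 : 0 < x by rewrite lt_def xN0.
have c1 : 0 < c + 1 by rewrite ltr_wpDl.
have := small (x / (c + 1)); rewrite divr_gt0// => /(_ isT).
by rewrite mulrCA ler_pMr// ler_pdivlMr// mul1r gerDl ler10.
Qed.

(** The cone of nonnegative scalars is closed; realness is part of the claim,
    since the order of the complex numbers is partial. *)
Lemma ge0_of_approx z :
  (forall e, 0 < e -> exists2 w, 0 <= w & `|z - w| <= e) -> 0 <= z.
Proof.
move=> appr.
have zr : z \is Num.real.
  apply/CrealP/eqP; rewrite -subr_eq0 -normr_eq0; apply/eqP.
  apply: (@le_all_eps_eq0 _ 2) => // e e0.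
  have [w w0 zw] := appr _ e0.
  have -> : z^* - z = (z - w)^* - (z - w).
    by rewrite rmorphB/= (geC0_conj w0); ring.
  by rewrite (le_trans (ler_normB _ _))// norm_conjC mulr2n mulrDl !mul1r lerD.
have [//|zlt0] := real_leP (real0 _) zr.
have [|w w0] := appr (- z / 2); first by rewrite divr_gt0// oppr_gt0.
rewrite ler0_norm ?subr_le0 ?(ltW (lt_le_trans zlt0 w0))// opprB => h.
have : - z <= - z / 2 by apply: le_trans h; rewrite lerDr.
by rewrite ler_pMr ?oppr_gt0// invf_ge1// (ler_nat _ 2 1).
Qed.

Lemma invn_small e : 0 < e ->
  exists N, forall n, (N <= n)%N -> n.+1%:R^-1 < e.
Proof.
move=> e0; have er : e = (complex.Re e)%:C%C by rewrite RRe_real// gtr0_real.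
have e0' : 0 < complex.Re e by rewrite er ltcR in e0.
exists (Num.truncn (complex.Re e)^-1) => n Nn.
rewrite invf_plt ?posrE ?ltr0Sn// er -fmorphV -(rmorph_nat (real_complex R)).
rewrite ltcR (lt_le_trans (truncnS_gt _))// ler_nat ltnS//.
Qed.

(** Elements above a common bound differ from it by real numbers, so the infimum
    of their real parts can be transported back. *)
Lemma complex_inf (A : set R[i]) m : A !=set0 -> (forall x, A x -> m <= x) ->
  exists2 d, (forall x, A x -> d <= x) &
    forall e, 0 < e -> exists2 x, A x & x < d + e.
Proof.
move=> [a0 Aa0] mA.
pose S := [set complex.Re x | x in A].
have EA x : A x -> x = (complex.Re x - complex.Re m)%:C%C + m.
  move=> /mA; rewrite lecE => /andP[/eqP i _].
  by rewrite [in RHS](complexE m) [LHS]complexE i rmorphB/=; ring.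
have Slb : has_inf S.
  split; first by exists (complex.Re a0), a0.
  exists (complex.Re m) => _ [x Ax <-].
  by have := mA _ Ax; rewrite lecE => /andP[].
exists ((inf S - complex.Re m)%:C%C + m) => [x Ax|e e0].
  rewrite (EA _ Ax) lerD2r lecR lerB// ge_inf//; first by case: Slb.
  by exists x.
have er : e = (complex.Re e)%:C%C by rewrite RRe_real// gtr0_real.
have e0' : 0 < complex.Re e by rewrite er ltcR in e0.
have [_ [x Ax <-] xlt] := inf_adherent e0' Slb.
exists x => //; rewrite (EA _ Ax) er addrAC ltrD2r -rmorphD/= ltcR.
by rewrite addrAC ltrD2r.
Qed.

End Complex.

(** * Inner products, density and completeness *)

Section HilbertBasics.
Variables (R : realType) (K : hilbertType R).
Implicit Types (x y z : K) (a : R[i]).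

Lemma hdotDl x y z : hdot (x + y) z = hdot x z + hdot y z.
Proof. exact: linearDl. Qed.

Lemma hdotBl x y z : hdot (x - y) z = hdot x z - hdot y z.
Proof. exact: linearBl. Qed.

Lemma hdotZl a x z : hdot (a *: x) z = a * hdot x z.
Proof. exact: linearZl_LR. Qed.

Lemma hdotC x y : hdot x y = (hdot y x)^*.
Proof. by rewrite hermC/= expr0 mul1r. Qed.

Lemma hdotDr x y z : hdot z (x + y) = hdot z x + hdot z y.
Proof. exact: linearDr. Qed.

Lemma hdotBr x y z : hdot z (x - y) = hdot z x - hdot z y.
Proof. exact: linearBr. Qed.

Lemma hdotZr a x z : hdot z (a *: x) = a^* * hdot z x.
Proof. exact: linearZr_LR. Qed.

Lemma hdot0l x : hdot 0 x = 0. Proof. exact: linear0l. Qed.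

Lemma hdot0r x : hdot x 0 = 0. Proof. exact: linear0r. Qed.

Lemma hdot_suml (I : Type) (r : seq I) (F : I -> K) z :
  hdot (\sum_(i <- r) F i) z = \sum_(i <- r) hdot (F i) z.
Proof. exact: linear_sumlz. Qed.

Lemma hdot_sumr (I : Type) (r : seq I) (F : I -> K) z :
  hdot z (\sum_(i <- r) F i) = \sum_(i <- r) hdot z (F i).
Proof. exact: linear_sumr. Qed.

Lemma hdotxx_ge0 x : 0 <= hdot x x.
Proof. by rewrite hdotxx exprn_ge0. Qed.

Lemma hdot_le x y : `|hdot x y| <= `|x| * `|y|.
Proof.
rewrite -(@ler_pXn2r _ 2) ?nnegrE ?mulr_ge0// exprMn -!hdotxx.
apply: (@hermitian_discriminant _ _ _ _ (hdot y x)) => [|a].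
  exact: hdotxx_ge0.
have := hdotxx_ge0 (a *: x + y).
rewrite hdotDl !hdotDr !hdotZl !hdotZr; congr (0 <= _); ring.
Qed.

Lemma hdotxx_eq0 x : hdot x x = 0 -> x = 0.
Proof.
by rewrite hdotxx => /eqP; rewrite expf_eq0/= normr_eq0 => /eqP.
Qed.

Lemma closure_approx (S : set K) x e : closure S x -> 0 < e ->
  exists2 s, S s & `|x - s| < e.
Proof.
move=> clx e0; have [s [Ss xs]] := clx _ (nbhsx_ballx x e e0).
by exists s => //; rewrite -ball_normE in xs.
Qed.

Lemma dense_orthogonal (S : set K) x : closure S = setT ->
  (forall s, S s -> hdot s x = 0) -> x = 0.
Proof.
move=> dS orth; apply/eqP/negP => /negP x0.
have xgt0 : 0 < `|x| by rewrite normr_gt0.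
have [|s Ss xs] := @closure_approx S x `|x| _ xgt0; first by rewrite dS.
have e : `|x| ^+ 2 = `|hdot (x - s) x|.
  by rewrite hdotBl (orth s)// subr0 hdotxx normrX normr_id.
have : `|x| ^+ 2 < `|x| ^+ 2.
  by rewrite {1}e (le_lt_trans (hdot_le _ _))// expr2 ltr_pM2r.
by rewrite ltxx.
Qed.

Lemma hilbert_complete (v : nat -> K) :
  (forall e : R[i], 0 < e -> exists N, forall n m, (N <= n)%N -> (N <= m)%N ->
     `|v n - v m| < e) ->
  exists w, forall e : R[i], 0 < e -> exists N, forall n, (N <= n)%N ->
    `|w - v n| < e.
Proof.
move=> cauchyv.
have : cauchy (v @ \oo).
  apply: cauchy_exP => e e0; have [N vN] := cauchyv _ e0.
  exists (v N); exists N => // n /= Nn; rewrite -ball_normE/=.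
  exact: vN.
move=> /cauchy_cvg/cvg_ex[w /cvgrPdist_lt vw]; exists w => e e0.
have [N _ wN] := vw _ e0.
by exists N => n Nn; exact: wN.
Qed.

End HilbertBasics.

(** * Riesz representation *)

Section Riesz.
Variables (R : realType) (K : hilbertType R).

(** Riesz representation for a bounded linear relation Gam between vectors and
    scalars; boundedness makes Gam the graph of a functional on a subspace,
    which need be neither closed nor dense.  As in the classical proof, w is the
    limit of a minimising sequence of |x|^2 - 2 Re c over Gam: the parallelogram
    identity makes the sequence Cauchy, and the first-order condition at an
    almost-minimiser is again [hermitian_discriminant]. *)
Lemma riesz_relation (Gam : K -> R[i] -> Prop) (M : R[i]) :
  Gam 0 0 ->
  (forall a x y c d, Gam x c -> Gam y d -> Gam (a *: x + y) (a * c + d)) ->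
  0 <= M -> (forall x c, Gam x c -> `|c| <= M * `|x|) ->
  exists w, forall x c, Gam x c -> c = hdot x w.
Proof.
move=> Gam0 GamP M0 GamM.
pose F (x : K) (c : R[i]) : R[i] := `|x| ^+ 2 - (c + c^*).
have [||d dF Fd] := @complex_inf _
  [set z | exists x c, Gam x c /\ z = F x c] (- M ^+ 2).
- by exists (F 0 0), 0, 0.
- move=> _ [x [c [Gxc ->]]].
  have le1 : c + c^* <= (M * `|x|) *+ 2.
    rewrite mulr2n; apply: le_trans (_ : `|c| + `|c^*| <= _); last first.
      by rewrite norm_conjC lerD ?GamM.
    apply: le_trans (ler_normD _ _); apply: real_ler_norm.
    by apply/CrealP; rewrite rmorphD/= conjCK addrC.
  rewrite /F lerBrDr -subr_ge0.
  have -> : `|x| ^+ 2 - (- M ^+ 2 + (c + c^*)) =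
            (`|x| - M) ^+ 2 + ((M * `|x|) *+ 2 - (c + c^*)) by ring.
  rewrite addr_ge0 ?subr_ge0// real_exprn_even_ge0//.
  by rewrite rpredB ?normr_real ?ger0_real.
have {}dF x c : Gam x c -> d <= F x c by move=> Gxc; apply: dF; exists x, c.
pose eps n : R[i] := n.+1%:R^-1.
have eps0 n : 0 < eps n by rewrite invr_gt0 ltr0Sn.
have /choice[p pP] n : exists p, Gam p.1 p.2 /\ F p.1 p.2 < d + eps n ^+ 2.
  have [|_ [x [c [Gxc ->]]] lt] := Fd (eps n ^+ 2); first by rewrite exprn_gt0.
  by exists (x, c).
(* The midpoint of two almost-minimisers cannot lie below the infimum. *)
have cau n m : `|(p n).1 - (p m).1| <= 2 * (eps n + eps m).
  rewrite -(@ler_pXn2r _ 2) ?nnegrE ?mulr_ge0 ?addr_ge0 ?(ltW (eps0 _))//.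
  have [G1 F1] := pP n; have [G2 F2] := pP m.
  have G3 : Gam (2^-1 *: ((p n).1 + (p m).1)) (2^-1 * ((p n).2 + (p m).2)).
    have G4 := GamP 1 _ _ _ _ G1 G2.
    rewrite scale1r mul1r in G4.
    by have := GamP 2^-1 _ _ _ _ G4 Gam0; rewrite !addr0.
  have := dF _ _ G3.
  move: F1 F2; rewrite /F -!hdotxx hdotZl hdotZr.
  rewrite !hdotBl !hdotBr !hdotDl !hdotDr.
  have half : (2^-1 : R[i])^* = 2^-1 by rewrite fmorphV/= conjC_nat.
  rewrite !rmorphM !rmorphD/= half.
  set a := hdot _ _; set b := hdot (p n).1 (p m).1; set b' := hdot (p m).1 _.
  set c := hdot (p m).1 _; set u := (p n).2; set v := (p m).2.
  set u' := u^*; set v' := v^*.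
  move=> F1 F2 F3.
  have F4 := lerD (lerD (ltW F1) (ltW F1)) (lerD (ltW F2) (ltW F2)).
  have F5 := lerD (lerD F3 F3) (lerD F3 F3).
  have F6 := lerD F4 F5.
  have {F6} : a - b - (c - b') <= 2 * (eps n ^+ 2 + eps m ^+ 2).
    rewrite -subr_ge0; rewrite -subr_ge0 in F6.
    by move: F6; congr (0 <= _); field.
  set z := 2 * _; move=> h.
  apply: le_trans h _; rewrite -subr_ge0.
  have -> : (2 * (eps n + eps m)) ^+ 2 - z =
            2 * (eps n ^+ 2 + eps m ^+ 2) + 8 * eps n * eps m.
    by rewrite /z; ring.
  by rewrite addr_ge0 ?mulr_ge0 ?addr_ge0 ?exprn_ge0 ?(ltW (eps0 _)).
have [w wP] : exists w, forall e : R[i], 0 < e ->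
    exists N, forall n, (N <= n)%N -> `|w - (p n).1| < e.
  apply: hilbert_complete => e e0.
  have [N NP] := @invn_small _ (e / 4) (divr_gt0 e0 (ltr0Sn _ _)).
  exists N => n m Nn Nm; rewrite (le_lt_trans (cau _ _))//.
  rewrite mulrC -ltr_pdivlMr//.
  have -> : e / 2 = e / 4 + e / 4 by field.
  by rewrite ltrD// NP.
exists w => x c Gxc.
(* Moving along a *: x from the n-th term lowers F by at most eps n ^+ 2. *)
have close n : `|hdot x (p n).1 - c| <= `|x| * eps n.
  rewrite -(@ler_pXn2r _ 2) ?nnegrE ?mulr_ge0 ?(ltW (eps0 _))// exprMn -hdotxx.
  have [G1 F1] := pP n.
  apply: (@hermitian_discriminant _ _ _ _ (hdot x (p n).1 - c)^*) => [|a].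
    exact: hdotxx_ge0.
  have := lerD (dF _ _ (GamP a _ _ _ _ Gxc G1)) (ltW F1).
  rewrite -subr_ge0 /F -!hdotxx hdotDl !hdotDr !hdotZl !hdotZr.
  rewrite !rmorphD/= rmorphN/= !rmorphM/= [hdot (p n).1 x]hdotC.
  by congr (0 <= _); ring.
apply/eqP; rewrite -subr_eq0 -normr_eq0; apply/eqP.
apply: (@le_all_eps_eq0 _ _ (`|x| + `|x|)) => //.
move=> e e0.
have [N1 P1] := wP _ e0; have [N2 P2] := invn_small e0.
pose n := maxn N1 N2.
have -> : c - hdot x w = - (hdot x (w - (p n).1)) - (hdot x (p n).1 - c).
  by rewrite hdotBr; ring.
rewrite (le_trans (ler_normB _ _))// normrN mulrDl lerD//.
  by rewrite (le_trans (hdot_le _ _))// ler_wpM2l// ltW// P1// leq_maxl.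
by rewrite (le_trans (close _))// ler_wpM2l// ltW// P2// leq_maxr.
Qed.

End Riesz.

Section Representation.
Variable R : realType.

(** Test against elements s of S close to w itself. *)
Lemma norm_le_dense (K : hilbertType R) (S : set K) (w : K) (m : R[i]) :
  closure S = setT -> 0 <= m -> (forall s, S s -> `|hdot s w| <= m * `|s|) ->
  `|w| <= m.
Proof.
move=> dS m0 wS.
have [|mw] := real_leP (ger0_real (normr_ge0 w)) (ger0_real m0); first by [].
have w0 : 0 < `|w| by apply: le_lt_trans mw.
have wm0 : 0 < `|w| + m by rewrite ltr_wpDr.
pose e := `|w| * (`|w| - m) / (`|w| + m).
have e0 : 0 < e by rewrite divr_gt0// mulr_gt0// subr_gt0.
have [|s Ss ws] := @closure_approx _ _ S w e _ e0; first by rewrite dS.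
have : `|w| ^+ 2 < e * `|w| + m * (`|w| + e).
  have -> : `|w| ^+ 2 = `|hdot (w - s) w + hdot s w|.
    by rewrite -hdotDl subrK hdotxx normrX normr_id.
  rewrite (le_lt_trans (ler_normD _ _))// ltr_leD//.
    by rewrite (le_lt_trans (hdot_le _ _))// ltr_pM2r.
  rewrite (le_trans (wS _ Ss))// ler_wpM2l//.
  have -> : s = w - (w - s) by rewrite opprB addrC subrK.
  by rewrite (le_trans (ler_normB _ _))// lerD2l ltW.
have -> : e * `|w| + m * (`|w| + e) = `|w| ^+ 2.
  by rewrite /e; field; rewrite gt_eqF.
by rewrite ltxx.
Qed.

(** A densely defined bounded linear relation has an everywhere defined adjoint,
    by Riesz representation of x |-> <y, z>.  For graphs this gives adjoints of
    operators; the general form lets [bounded_form_operator] bypass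
    the extension of a densely defined operator. *)
Lemma relation_adjoint (H K : hilbertType R) (W : H -> K -> Prop) (M : R[i]) :
  (forall a x y x' y', W x y -> W x' y' -> W (a *: x + x') (a *: y + y')) ->
  0 <= M -> (forall x y, W x y -> `|y| <= M * `|x|) ->
  closure [set x | exists y, W x y] = setT ->
  exists B : 'L(K, H), forall x y z, W x y -> hdot y z = hdot x (B z).
Proof.
move=> WP M0 WM dW.
have [x0 [[y0 W0] _]] : exists s, (exists y, W s y) /\ `|(0 : H) - s| < 1.
  have [|s Ss s1] := @closure_approx _ _ [set x | exists y, W x y] 0 1 _ ltr01.
    by rewrite dW.
  by exists s.
have W00 : W 0 0.
  by have := WP (-1) _ _ _ _ W0 W0; rewrite !scaleN1r !addNr.
have /choice[B BP] z : exists w, forall x y, W x y -> hdot y z = hdot x w.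
  have [||||w wP] :=
    @riesz_relation R H (fun x c => exists2 y, W x y & c = hdot y z) (M * `|z|).
  - by exists 0 => //; rewrite hdot0l.
  - move=> a x x' c d [y Wxy ->] [y' Wxy' ->]; exists (a *: y + y').
      exact: WP.
    by rewrite hdotDl hdotZl.
  - by rewrite mulr_ge0.
  - move=> x c [y Wxy ->]; rewrite (le_trans (hdot_le _ _))// mulrAC.
    by rewrite ler_wpM2r// WM.
  - by exists w => x y Wxy; apply: wP; exists y.
have linB : linear B.
  move=> a z z'; apply/eqP; rewrite -subr_eq0; apply/eqP.
  apply: dense_orthogonal dW _ => x [y Wxy].
  rewrite hdotBr hdotDr hdotZr -!(BP _ _ _ Wxy) hdotDr hdotZr.
  by rewrite subrr.
have bndB z : `|B z| <= M * `|z|.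
  apply: norm_le_dense dW _ _ => [|x [y Wxy]]; first by rewrite mulr_ge0.
  rewrite -(BP _ _ _ Wxy) (le_trans (hdot_le _ _))// mulrAC.
  by rewrite ler_wpM2r// WM.
have bB : B \in is_bounded_operator by apply/asboolP; split=> //; exists M.
by exists (Operator bB) => x y z Wxy; exact: BP.
Qed.

(** [relation_adjoint] for the graph of A provides an element of the set from
    which [adjoint] chooses. *)
Lemma adjointP (H K : hilbertType R) (A : 'L(H, K)) x y :
  hdot (A x) y = hdot x (adjoint A y).
Proof.
have [M M0 AM] := operator_bounded A.
have [| | | |B BP] := @relation_adjoint H K (fun x y => y = A x) M.
- by move=> a u v u' v' -> ->; rewrite linearP.
- exact: M0.
- by move=> u _ ->.
- rewrite -subTset => u _; apply: subset_closure; by exists (A u).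
rewrite /adjoint; case: xgetP => [B' _ /= h|/(_ B)]; first exact: h.
by case=> u v /=; rewrite (BP _ _ _ erefl).
Qed.

Lemma adjointPr (H K : hilbertType R) (A : 'L(H, K)) x y :
  hdot (adjoint A x) y = hdot x (A y).
Proof. by rewrite hdotC -adjointP -hdotC. Qed.

(** The vectors j l are given by representatives l, and the form B is given on
    representatives only; that it depends on j l and j m alone follows from the
    bound.  Representing B l gives a vector w l, and T is the double
    adjoint of the relation between j l and w l. *)
Lemma bounded_form_operator (E : Type) (K : hilbertType R) (j : E -> K)
    (B : E -> E -> R[i]) (M : R[i]) :
  (forall a l l', exists l'', [/\ j l'' = a *: j l + j l',
     forall m, B l'' m = a * B l m + B l' m &
     forall m, B m l'' = a^* * B m l + B m l']) ->
  0 <= M -> (forall l m, `|B l m| <= M * `|j l| * `|j m|) ->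
  closure (range j) = setT ->
  exists T : 'L(K), forall l m, hdot (T (j l)) (j m) = B l m.
Proof.
move=> BP M0 BM dj.
have [l0 [j0 Bl0 B0l]] : exists l0, [/\ j l0 = 0, forall m, B l0 m = 0 &
    forall m, B m l0 = 0].
  have [|_ [l _ _]  _] := @closure_approx _ _ (range j) 0 1 _ ltr01.
    by rewrite dj.
  have [l0 [j0 Bl0 B0l]] := BP (-1) l l.
  exists l0; split=> [|m|m]; rewrite (j0, Bl0, B0l).
  - by rewrite scaleN1r addNr.
  - by rewrite mulN1r addNr.
  - by rewrite conjCN1 mulN1r addNr.
have /choice[w wP] l : exists w, forall m, hdot w (j m) = B l m.
  have [||||w wP] := @riesz_relation R K
    (fun x c => exists2 m, x = j m & c = (B l m)^*) (M * `|j l|).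
  - by exists l0; rewrite ?j0// B0l conjC0.
  - move=> a x y c d [m -> ->] [m' -> ->].
    have [m'' [jm'' _ Bm'']] := BP a m m'.
    by exists m''; rewrite ?jm''// Bm'' rmorphD rmorphM/= conjCK.
  - by rewrite mulr_ge0.
  - by move=> x c [m -> ->]; rewrite norm_conjC.
  - by exists w => m; rewrite hdotC -(wP (j m) (B l m)^*) ?conjCK//; exists m.
have [| | | |S SP] := @relation_adjoint K K
    (fun u v => exists l, u = j l /\ forall m, hdot v (j m) = B l m) M.
- move=> a x y x' y' [l [-> yP]] [l' [-> yP']].
  have [l'' [jl'' Bl'' _]] := BP a l l'.
  by exists l''; split=> [//|m]; rewrite hdotDl hdotZl yP yP' Bl''.
- by [].
- move=> x y [l [-> yP]]; apply: norm_le_dense dj _ _ => [|_ [m _ <-]].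
    by rewrite mulr_ge0.
  by rewrite hdotC norm_conjC yP.
- rewrite -subTset -dj; apply: closure_subset => _ [l _ <-].
  by exists (w l), l.
exists (adjoint S) => l m; rewrite adjointPr -(SP (j l) (w l)) ?wP//.
by exists l.
Qed.

End Representation.

(** * Positive operators *)

Section LogConvex.
Variable R : realType.

Lemma bernoulli (t : R[i]) n : 0 <= t -> 1 + n%:R * t <= (1 + t) ^+ n.
Proof.
move=> t0; elim: n => [|n IH]; first by rewrite mul0r addr0 expr0.
rewrite exprS; apply: le_trans (ler_wpM2l _ IH); last by rewrite addr_ge0.
rewrite -subr_ge0 (_ : _ - _ = n%:R * t ^+ 2); last by rewrite -natr1; ring.
by rewrite mulr_ge0 ?ler0n ?exprn_ge0.
Qed.

(** Ratios of consecutive terms of a log-convex sequence increase, so the first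
    ratio is at most the exponential growth rate. *)
Lemma log_convex_growth (r : nat -> R[i]) (c D : R[i]) :
  0 < c -> 0 <= D -> (forall n, 0 <= r n) ->
  (forall n, r n.+1 ^+ 2 <= r n * r n.+2) ->
  (forall n, r n <= D * c ^+ n) -> r 1%N <= c * r 0%N.
Proof.
move=> c0 D0 r0 rconv rD.
have [//|cr] : r 1%N <= c * r 0%N \/ c * r 0%N < r 1%N.
  have cr0 := mulr_ge0 (ltW c0) (r0 0%N).
  by case: (real_leP (ger0_real (r0 1%N)) (ger0_real cr0)); [left|right].
have r1 : 0 < r 1%N by apply: le_lt_trans cr; rewrite mulr_ge0// ltW.
have r00 : 0 < r 0%N.
  rewrite lt_def r0 andbT; apply: contraTneq (rconv 0%N) => ->.
  by rewrite mul0r lt_geF// exprn_gt0.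
pose q := r 1%N / r 0%N.
have q0 : 0 < q by rewrite divr_gt0.
have qc : c < q by rewrite ltr_pdivlMr.
have grow n : 0 < r n /\ q * r n <= r n.+1.
  elim: n => [|n [rn0 qrn]]; first by rewrite /q divfK ?gt_eqF.
  have rn1 : 0 < r n.+1 by apply: lt_le_trans qrn; rewrite mulr_gt0.
  split=> //; rewrite -(ler_pM2l rn0); apply: le_trans (rconv n).
  by rewrite mulrA [r n * q]mulrC expr2 ler_wpM2r// ltW.
have rq n : q ^+ n * r 0%N <= r n.
  elim: n => [|n IH]; first by rewrite expr0 mul1r.
  by rewrite exprS -mulrA (le_trans _ (grow n).2)// ler_wpM2l// ltW.
pose t := (q - c) / c.
have t0 : 0 < t by rewrite divr_gt0// subr_gt0.
have bnd n : (1 + n%:R * t) * r 0%N <= D.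
  have cn0 : 0 < c ^+ n by rewrite exprn_gt0.
  rewrite -(ler_pM2r cn0) (le_trans _ (rD n))// (le_trans _ (rq n))//.
  have -> : q = (1 + t) * c by rewrite /t; field; rewrite gt_eqF.
  rewrite exprMn -mulrA [X in _ <= X]mulrAC -mulrA.
  rewrite ler_wpM2r ?mulr_ge0 ?(ltW cn0)//.
  by rewrite bernoulli// ltW.
have D1 : 0 < D + 1 by rewrite ltr_wpDl.
have [N /(_ N (leqnn N)) h] := invn_small (divr_gt0 (mulr_gt0 t0 r00) D1).
have {}h : D + 1 < N.+1%:R * (t * r 0%N).
  by rewrite ltr_pdivlMr// in h; rewrite mulrC -ltr_pdivrMr ?ltr0Sn// mulrC.
have : D + 1 < D.
  apply: lt_le_trans h _; apply: le_trans (bnd N.+1).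
  by rewrite mulrDl mul1r -mulrA lerDr.
by rewrite gtrDl ltr10.
Qed.

End LogConvex.

Section PositiveOperators.
Variables (R : realType) (K : hilbertType R).
Implicit Types (T A B : 'L(K)) (x y : K).

Lemma op_ge0_coef T x y : op_ge0 T -> forall a : R[i],
  0 <= a * a^* * hdot (T x) x + a * hdot (T x) y + a^* * hdot (T y) x
       + hdot (T y) y.
Proof.
move=> T0 a; have := T0 (a *: x + y).
rewrite (linearP T) hdotDl !hdotDr !hdotZl !hdotZr.
by congr (0 <= _); ring.
Qed.

Lemma op_ge0_CauchySchwarz T x y : op_ge0 T ->
  `|hdot (T x) y| ^+ 2 <= hdot (T x) x * hdot (T y) y.
Proof.
by move=> T0; exact: hermitian_discriminant (T0 x) (op_ge0_coef x y T0).
Qed.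

(** Cauchy-Schwarz for the form of T, applied to x and T x. *)
Lemma op_ge0_sqr_norm T : op_ge0 T ->
  exists2 M : R[i], 0 <= M & forall x, `|T x| ^+ 2 <= M * hdot (T x) x.
Proof.
move=> T0; have [M M0 TM] := operator_bounded T; exists M => // x.
have [->|Tx0] := eqVneq (T x) 0.
  by rewrite normr0 expr0n hdot0l mulr0.
have n0 : 0 < `|T x| ^+ 2 by rewrite exprn_gt0// normr_gt0.
have := op_ge0_CauchySchwarz x (T x) T0.
rewrite hdotxx normrX normr_id expr2 => h; rewrite -(ler_pM2r n0).
apply: le_trans h _; rewrite [X in _ <= X]mulrAC [M * _ * _]mulrC ler_wpM2l//.
rewrite -[X in X <= _]ger0_norm// (le_trans (hdot_le _ _))//.
by rewrite expr2 mulrA ler_wpM2r.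
Qed.

(** With A = B^* B, which is symmetric and commutes with T, this is
    <T x, A x> <= m <T x, x>.  The numbers <T A^n x, A^n x> form a log-convex
    sequence by Cauchy-Schwarz for the form of T, and grow at most like
    |A|^(2n); comparing the first two terms gives the bound without a square
    root of T. *)
Lemma op_ge0_conj T B : op_ge0 T -> (forall x, T (B x) = B (T x)) ->
  (forall x, T (adjoint B x) = adjoint B (T x)) ->
  exists2 m : R[i], 0 < m &
    forall x, hdot (T (B x)) (B x) <= m * hdot (T x) x.
Proof.
move=> T0 TB TBs; pose A := adjoint B *o B.
have TA x : T (A x) = A (T x) by rewrite /= TBs TB.
have AE x y : hdot (A x) y = hdot (B x) (B y) by rewrite /= adjointPr.
have As x y : hdot (A x) y = hdot x (A y).
  by rewrite AE [RHS]hdotC AE -hdotC.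
have [M0 M00 AM0] := operator_bounded A.
pose M := M0 + 1.
have M1 : 0 < M by rewrite ltr_wpDl.
have AM x : `|A x| <= M * `|x|.
  by rewrite (le_trans (AM0 x))// ler_wpM2r// lerDl.
have [N N0 TN] := operator_bounded T.
exists M => // x; pose r n := hdot (T (iter n A x)) (iter n A x).
have TE (y : K) : hdot (T (B y)) (B y) = hdot (T y) (A y).
  by rewrite TB -AE -As.
have r01 : r 1%N <= M ^+ 2 * r 0%N.
  apply: (@log_convex_growth _ r _ (N * `|x| ^+ 2)) => [|||n|n].
  - by rewrite exprn_gt0.
  - by rewrite mulr_ge0// exprn_ge0.
  - by move=> n; exact: T0.
  - have := op_ge0_CauchySchwarz (iter n A x) (iter n.+2 A x) T0.
    rewrite (_ : hdot _ _ = r n.+1) ?(ger0_norm (T0 _))//.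
    by rewrite /r [iter n.+2 A x]iterS -As -TA -iterS.
  - rewrite /r -[X in X <= _]ger0_norm// (le_trans (hdot_le _ _))//.
    have itB : `|iter n A x| <= M ^+ n * `|x|.
      elim: n => [|n IH]; first by rewrite expr0 mul1r.
      by rewrite iterS exprS -mulrA (le_trans (AM _))// ler_wpM2l// ltW.
    have -> : N * `|x| ^+ 2 * (M ^+ 2) ^+ n =
              (N * (M ^+ n * `|x|)) * (M ^+ n * `|x|).
      by rewrite exprAC !expr2; ring.
    by rewrite ler_pM// (le_trans (TN _))// ler_wpM2l.
have s0 : 0 <= hdot (T x) (A x) by rewrite -TE; exact: T0.
have x0 : 0 <= hdot (T x) x by exact: T0.
rewrite TE -(@ler_pXn2r _ 2) ?nnegrE ?s0 ?mulr_ge0 ?(ltW M1)//.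
rewrite -[X in X ^+ 2 <= _](ger0_norm s0).
apply: le_trans (op_ge0_CauchySchwarz x (A x) T0) _.
rewrite (_ : (M * hdot (T x) x) ^+ 2 = hdot (T x) x * (M ^+ 2 * hdot (T x) x)).
  by rewrite ler_wpM2l.
by ring.
Qed.

Lemma op_ge0_dense T (S : set K) : closure S = setT ->
  (forall s, S s -> 0 <= hdot (T s) s) -> op_ge0 T.
Proof.
move=> dS TS x; apply: ge0_of_approx => e e0.
have [M M0 TM] := operator_bounded T.
pose c := M * (2 * `|x| + 1) + 1.
have c0 : 0 < c by rewrite ltr_wpDl// mulr_ge0// addr_ge0// mulr_ge0.
pose d := e / (e + c).
have ec0 : 0 < e + c by rewrite addr_gt0.
have d0 : 0 < d by rewrite divr_gt0.
have d1 : d <= 1 by rewrite ler_pdivrMr// mul1r lerDl ltW.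
have [|s Ss xs] := @closure_approx _ _ S x d _ d0; first by rewrite dS.
exists (hdot (T s) s); first exact: TS.
have -> : hdot (T x) x - hdot (T s) s = hdot (T x) (x - s) + hdot (T (x - s)) s.
  by rewrite (raddfB T) hdotBl hdotBr; ring.
have sx : `|s| <= `|x| + 1.
  have -> : s = x - (x - s) by rewrite opprB addrC subrK.
  by rewrite (le_trans (ler_normB _ _))// lerD2l (le_trans (ltW xs)).
have h1 : `|hdot (T x) (x - s)| <= M * `|x| * d.
  by rewrite (le_trans (hdot_le _ _))// ler_pM// ltW.
have h2 : `|hdot (T (x - s)) s| <= M * d * (`|x| + 1).
  rewrite (le_trans (hdot_le _ _))// ler_pM// (le_trans (TM _))//.
  by rewrite ler_wpM2l// ltW.
rewrite (le_trans (ler_normD _ _))// (le_trans (lerD h1 h2))//.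
have -> : M * `|x| * d + M * d * (`|x| + 1) = (c - 1) * d by rewrite /c; ring.
rewrite /d mulrCA -ler_pdivlMl// mulVf ?gt_eqF// ler_pdivrMr// mul1r.
by rewrite lerBlDr -addrA [c + 1]addrC addrA lerDr addr_ge0// ltW.
Qed.

End PositiveOperators.

(** * Matrices of operators *)

Section OperatorFacts.
Variable R : realType.
Implicit Types H K L : hilbertType R.

Lemma op_eq H K (A B : 'L(H, K)) : (forall x, A x = B x) -> A = B.
Proof. by move=> AB; apply: val_inj; apply: funext. Qed.

Lemma op_eq_weak H K (A B : 'L(H, K)) :
  (forall x y, hdot (A x) y = hdot (B x) y) -> A = B.
Proof.
move=> AB; apply: op_eq => x; apply/eqP; rewrite -subr_eq0; apply/eqP.
by apply: hdotxx_eq0; rewrite hdotBl AB subrr.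
Qed.

Lemma opB H K (A B : 'L(H, K)) x : (A - B) x = A x - B x.
Proof. by []. Qed.

Lemma opD H K (A B : 'L(H, K)) x : (A + B) x = A x + B x.
Proof. by []. Qed.

Lemma opZ H K a (A : 'L(H, K)) x : (a *: A) x = a *: A x.
Proof. by []. Qed.

Lemma opcompE H K L (A : 'L(K, L)) (B : 'L(H, K)) x : (A *o B) x = A (B x).
Proof. by []. Qed.

Definition opform H n (A : 'M['L(H)]_n) (x : 'I_n -> H) : R[i] :=
  hdotn (opmx_app A x) x.

Lemma opformE H n (A : 'M['L(H)]_n) (x : 'I_n -> H) :
  opform A x = \sum_i \sum_j hdot (A i j (x j)) (x i).
Proof. by apply: eq_bigr => i _; rewrite hdot_suml. Qed.

Lemma opformB H n (A B : 'M['L(H)]_n) (x : 'I_n -> H) :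
  opform (A - B) x = opform A x - opform B x.
Proof.
rewrite !opformE -sumrB; apply: eq_bigr => i _; rewrite -sumrB.
by apply: eq_bigr => j _; rewrite !mxE opB hdotBl.
Qed.

Lemma opformZ H n a (A : 'M['L(H)]_n) (x : 'I_n -> H) :
  opform (opmx_scale a A) x = a * opform A x.
Proof.
rewrite !opformE big_distrr; apply: eq_bigr => i _ /=; rewrite big_distrr.
by apply: eq_bigr => j _; rewrite !mxE opZ hdotZl.
Qed.

Lemma opmx_leP H n (A B : 'M['L(H)]_n) :
  (forall x, opform A x <= opform B x) -> opmx_le A B.
Proof. by move=> AB x; rewrite -/(opform _ _) opformB subr_ge0. Qed.

End OperatorFacts.

(** * Compressions of a minimal Stinespring construction *)

Section Stinespring.
Variables (R : realType) (G : groupType) (alpha : G -> G).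
Variables (H K : hilbertType R) (phi : G -> 'L(H)).
Variables (J : 'L(K)) (pi : G -> 'L(K)) (V : 'L(H, K)).
Hypothesis alphaI : involution alpha.
Hypothesis stine : minimal_stinespring alpha phi pi J V.
Implicit Types (g h : G) (x y : H) (T : 'L(K)) (psi : G -> 'L(H)).

Lemma hdotJ u v : hdot (J u) v = hdot u (J v).
Proof. by case: stine => -[Ja _] _ _ _ _; rewrite adjointP Ja. Qed.

Lemma JK u : J (J u) = u.
Proof. by case: stine => -[_ JJ] _ _ _ _; rewrite -opcompE JJ. Qed.

Lemma piM g h u : pi (g * h)%g u = pi g (pi h u).
Proof. by case: stine => _ [-> _ _]. Qed.

Lemma pi1 u : pi 1%g u = u.
Proof. by case: stine => _ [_ -> _]. Qed.

Lemma adjoint_pi g u : adjoint (pi g) u = J (pi (g^-1)%g (J u)).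
Proof. by case: stine => _ [_ _ ->] /=; rewrite !JK. Qed.

Lemma JpiV g x : J (pi g (V x)) = pi (alpha g) (V x).
Proof.
by case: stine => _ _ _ h _; rewrite -[LHS]/((J *o pi g *o V) x) h.
Qed.

Lemma alphaK g : alpha (alpha g) = g.
Proof. by case: alphaI. Qed.

Lemma alpha1 : alpha 1%g = 1%g.
Proof. by case: alphaI. Qed.

Lemma alphaV g : alpha (g^-1)%g = (alpha g)^-1%g.
Proof. by case: alphaI. Qed.

Lemma JV x : J (V x) = V x.
Proof.
by rewrite -{1}[V x]pi1 JpiV alpha1 pi1.
Qed.

Lemma adjoint_pi_orbit k g x :
  adjoint (pi k) (pi g (V x)) = pi (alpha (k^-1 * alpha g))%g (V x).
Proof. by rewrite adjoint_pi JpiV -piM JpiV. Qed.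

Lemma compressE T g x y :
  hdot (compress pi V T g x) y = hdot (T (pi g (V x))) (V y).
Proof. exact: adjointPr. Qed.

(** The adjoint of pi(alpha(g)^-1) is J pi(alpha(g)) J, and J fixes the range of
    V and exchanges pi(alpha(g))V with pi(g)V, so this adjoint sends
    V y to pi(g)V y. *)
Lemma compress_gram T g h x y : commutant pi T ->
  hdot (compress pi V T ((alpha g)^-1 * h)%g x) y =
  hdot (T (pi h (V x))) (pi g (V y)).
Proof.
move=> cT; rewrite compressE piM -[T (pi _ _)]/((T *o pi _) _) cT /=.
by rewrite adjointP -{1}[V y]pi1 adjoint_pi_orbit alpha1 invgK mulg1 alphaK.
Qed.


Definition orbit_sum (l : seq (G * H)) : K := \sum_(p <- l) pi p.1 (V p.2).

(** The sesquilinear form of the kernel psi(alpha(g)^-1 h) on formal sums,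
    which are lists of pairs (g, x) standing for the vectors [orbit_sum]. *)
Definition gram psi (l m : seq (G * H)) : R[i] :=
  \sum_(q <- m) \sum_(p <- l) hdot (psi ((alpha q.1)^-1 * p.1)%g p.2) q.2.

Definition formal_sum n (g : 'I_n -> G) (x : 'I_n -> H) : seq (G * H) :=
  [seq (g i, x i) | i <- enum 'I_n].

Definition formal_axpy (a : R[i]) (l m : seq (G * H)) : seq (G * H) :=
  [seq (p.1, a *: p.2) | p <- l] ++ m.

Lemma orbit_sum_formal n (g : 'I_n -> G) (x : 'I_n -> H) :
  orbit_sum (formal_sum g x) = \sum_i pi (g i) (V (x i)).
Proof. by rewrite /orbit_sum big_map big_enum. Qed.

Lemma opform_gram psi n (g : 'I_n -> G) (x : 'I_n -> H) :
  opform (acp_mx alpha psi g) x = gram psi (formal_sum g x) (formal_sum g x).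
Proof.
rewrite opformE /gram big_map big_enum; apply: eq_bigr => i _.
by rewrite big_map big_enum; apply: eq_bigr => j _; rewrite mxE.
Qed.

Lemma formal_sum_surj l :
  exists n (g : 'I_n -> G) (x : 'I_n -> H), l = formal_sum g x.
Proof.
exists (size l), (fun i => (tnth (in_tuple l) i).1),
  (fun i => (tnth (in_tuple l) i).2).
rewrite -[LHS](map_tnth_enum (in_tuple l)).
by apply: eq_map => i; rewrite -surjective_pairing.
Qed.

Lemma gram_ge0P psi :
  (forall n (g : 'I_n -> G), opmx_ge0 (acp_mx alpha psi g)) <->
  (forall l, 0 <= gram psi l l).
Proof.
split=> [pos l|pos n g x]; last by rewrite -/(opform _ _) opform_gram.
by have [n [g [x ->]]] := formal_sum_surj l; rewrite -opform_gram; exact: pos.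
Qed.

Lemma orbit_sum_axpy a l m :
  orbit_sum (formal_axpy a l m) = a *: orbit_sum l + orbit_sum m.
Proof.
rewrite /orbit_sum /formal_axpy big_cat big_map /= scaler_sumr; congr (_ + _).
by apply: eq_bigr => p _; rewrite !linearZ.
Qed.

Lemma gram_axpyl psi a l l' m :
  gram psi (formal_axpy a l l') m = a * gram psi l m + gram psi l' m.
Proof.
rewrite /gram big_distrr -big_split; apply: eq_bigr => q _ /=.
rewrite /formal_axpy big_cat big_map /= big_distrr; congr (_ + _).
by apply: eq_bigr => p _; rewrite linearZ hdotZl.
Qed.

Lemma gram_axpyr psi a l l' m :
  gram psi m (formal_axpy a l l') = a^* * gram psi m l + gram psi m l'.
Proof.
rewrite /gram /formal_axpy big_cat big_map /= big_distrr; congr (_ + _).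
apply: eq_bigr => q _ /=; rewrite big_distrr.
by apply: eq_bigr => p _; rewrite hdotZr.
Qed.

Lemma gramB psi1 psi2 l m :
  gram (psi1 - psi2) l m = gram psi1 l m - gram psi2 l m.
Proof.
rewrite /gram -sumrB; apply: eq_bigr => q _; rewrite -sumrB.
by apply: eq_bigr => p _; rewrite -hdotBl.
Qed.

Lemma gramZ a psi l m : gram (a *: psi) l m = a * gram psi l m.
Proof.
rewrite /gram big_distrr; apply: eq_bigr => q _; rewrite /= big_distrr.
by apply: eq_bigr => p _; exact: hdotZl.
Qed.

Lemma gram_compress T l m : commutant pi T ->
  gram (compress pi V T) l m = hdot (T (orbit_sum l)) (orbit_sum m).
Proof.
move=> cT; rewrite hdot_sumr; apply: eq_bigr => q _.
rewrite raddf_sum hdot_suml; apply: eq_bigr => p _.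
by rewrite compress_gram.
Qed.

Lemma phiE : phi = compress pi V (opid K).
Proof.
case: stine => _ _ h _ _; apply: funext => g; rewrite h.
by apply: op_eq => x.
Qed.

Lemma commutant_opid : commutant pi (opid K).
Proof. by move=> g; apply: op_eq. Qed.

Lemma gram_phi l m : gram phi l m = hdot (orbit_sum l) (orbit_sum m).
Proof. by rewrite phiE gram_compress//; exact: commutant_opid. Qed.

Lemma orbit_sum_dense : closure (range orbit_sum) = setT.
Proof.
case: stine => _ _ _ _ d; rewrite -subTset -d; apply: closure_subset.
move=> _ [n [c [s [/choice[g /choice[x sE]] ->]]]].
exists (formal_sum g (fun i => c i *: x i)) => //.
by rewrite orbit_sum_formal; apply: eq_bigr => i _; rewrite sE !linearZ.
Qed.

Lemma orbit_orthogonal_eq0 w : (forall g x, hdot (pi g (V x)) w = 0) -> w = 0.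
Proof.
move=> h; apply: dense_orthogonal orbit_sum_dense _ => _ [l _ <-].
by rewrite hdot_suml big1_seq.
Qed.

Lemma op_eq_orbit (A B : 'L(K)) :
  (forall h x g y, hdot (A (pi h (V x))) (pi g (V y)) =
                   hdot (B (pi h (V x))) (pi g (V y))) -> A = B.
Proof.
move=> AB.
have e h x : A (pi h (V x)) = B (pi h (V x)).
  apply/eqP; rewrite -subr_eq0; apply/eqP; apply: orbit_orthogonal_eq0 => g y.
  by rewrite hdotC hdotBl AB subrr conjC0.
apply: op_eq_weak => u v; rewrite !adjointP.
apply/eqP; rewrite -subr_eq0 -hdotBr; apply/eqP.
rewrite (_ : _ - _ = 0) ?hdot0r//; apply: orbit_orthogonal_eq0 => g y.
by rewrite hdotBr -!adjointP e subrr.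
Qed.

Lemma compress_inj T S : commutant pi T -> commutant pi S ->
  compress pi V T = compress pi V S -> T = S.
Proof.
move=> cT cS TS; apply: op_eq_orbit => h x g y.
by rewrite -!compress_gram// TS.
Qed.

(** Cauchy-Schwarz for the form of psi, followed by the domination hypothesis:
    the form of phi at l is the square of the norm of [orbit_sum l]. *)
Lemma gram_bound psi lambda : 0 <= lambda ->
  (forall l, 0 <= gram psi l l) ->
  (forall l, gram psi l l <= lambda * gram phi l l) ->
  forall l m, `|gram psi l m| <= lambda * `|orbit_sum l| * `|orbit_sum m|.
Proof.
move=> la0 pos dom l m.
rewrite -(@ler_pXn2r _ 2) ?nnegrE ?mulr_ge0//.
have := @hermitian_discriminant _ (gram psi l l) (gram psi m m) (gram psi l m)
  (gram psi m l) (pos l).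
move=> /(_ _)/le_trans; apply=> [a|].
  have := pos (formal_axpy a l m); rewrite gram_axpyl !gram_axpyr.
  by congr (0 <= _); ring.
rewrite (_ : (_ * _) ^+ 2 =
  (lambda * `|orbit_sum l| ^+ 2) * (lambda * `|orbit_sum m| ^+ 2)).
  by rewrite -!hdotxx -!gram_phi ler_pM.
by ring.
Qed.

(** T represents the form of psi.  Its commutation relations hold because
    pi(k) and J permute the vectors pi(h)Vx up to alpha, so that both sides
    become values of psi at the same group element.  The domination is a
    hypothesis on forms, so that [RN_derivative_le] can obtain it by chaining
    two such inequalities. *)
Lemma RN_exists psi lambda : 0 <= lambda ->
  (forall g h, psi (alpha g * alpha h)%g = psi (g * h)%g) ->
  (forall l, 0 <= gram psi l l) ->
  (forall l, gram psi l l <= lambda * gram phi l l) ->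
  exists2 T, RN_target pi J T & psi = compress pi V T.
Proof.
move=> la0 psia pos dom.
have [||||T TP] := @bounded_form_operator R _ K orbit_sum (gram psi) lambda.
- move=> a l l'; exists (formal_axpy a l l'); split=> [|m|m].
  + exact: orbit_sum_axpy.
  + exact: gram_axpyl.
  + exact: gram_axpyr.
- exact: la0.
- exact: gram_bound.
- exact: orbit_sum_dense.
have TE h x g y : hdot (T (pi h (V x))) (pi g (V y)) =
    hdot (psi ((alpha g)^-1 * h)%g x) y.
  have := TP [:: (h, x)] [:: (g, y)].
  by rewrite /orbit_sum /gram !big_seq1.
have Tpos : op_ge0 T.
  by apply: op_ge0_dense orbit_sum_dense _ => _ [l _ <-]; rewrite TP.
have cT : commutant pi T.
  (* pi(k)^* maps pi(g)Vy to pi(alpha(k^-1 alpha(g)))Vy. *)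
  move=> k; apply: op_eq_orbit => h x g y /=.
  rewrite -piM TE [RHS]hdotC -adjointPr adjoint_pi_orbit -hdotC TE.
  by rewrite alphaK invgM invgK mulgA.
exists T.
  split=> //; apply: op_eq_orbit => h x g y /=.
  rewrite JpiV TE [RHS]hdotJ JpiV TE.
  by rewrite alphaK -alphaV psia.
apply: funext => g; apply: op_eq_weak => x y.
by rewrite compressE -[V y]pi1 TE alpha1 invg1 mul1g.
Qed.

(** The two operator inequalities required are [op_ge0_sqr_norm], combined with
    the boundedness of V, and [op_ge0_conj] for pi(h). *)
Lemma compress_alphaCP T : RN_target pi J T -> alphaCP alpha (compress pi V T).
Proof.
move=> [cT TJ T0].
have TJE u : T (J u) = J (T u) by rewrite -[LHS]/((T *o J) u) TJ.
have Tpi g u : T (pi g u) = pi g (T u) by rewrite -[LHS]/((T *o pi g) u) cT.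
have aE g : compress pi V T (alpha g) = compress pi V T g.
  by apply: op_eq_weak => x y; rewrite !compressE -JpiV TJE hdotJ JV.
split.
- move=> g1 g2; rewrite aE; split=> //; apply: op_eq_weak => x y.
  have -> : (alpha g1 = (alpha (g1^-1))^-1)%g by rewrite alphaV invgK.
  by rewrite compress_gram// -JpiV TJE hdotJ JpiV -compress_gram// alphaK invgK.
- move=> n g x; rewrite -/(opform _ _) opform_gram gram_compress//; exact: T0.
(* The constant is increased by 1 to make it positive even if V or T is 0. *)
- have [M M0 TM] := op_ge0_sqr_norm T0.
  have [N N0 VN] := operator_bounded (adjoint V).
  exists (N ^+ 2 * M + 1); first by rewrite ltr_wpDl// mulr_ge0// exprn_ge0.
  move=> n g; apply: opmx_leP => x.
  rewrite opformZ opform_gram gram_compress// orbit_sum_formal.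
  set u := \sum_i _.
  have -> : opform (\matrix_(i, j) (adjoint (compress pi V T (g i)) *o
      compress pi V T (g j))) x = `|adjoint V (T u)| ^+ 2.
    rewrite opformE -hdotxx /u (raddf_sum T) (raddf_sum (adjoint V)).
    rewrite hdot_sumr; apply: eq_bigr => i _.
    rewrite hdot_suml; apply: eq_bigr => j _; rewrite mxE /=.
    by rewrite adjointPr.
  have Tu0 := T0 u.
  rewrite mulrDl mul1r ler_wpDr// -mulrA.
  apply: le_trans (ler_wpM2l _ (TM u)); last by rewrite exprn_ge0.
  by rewrite -exprMn lerXn2r ?nnegrE ?mulr_ge0.
- move=> h.
  have [||m m0 mP] := @op_ge0_conj R K T (pi h) T0; first exact: Tpi.
    by move=> u; rewrite !adjoint_pi TJE Tpi TJE.
  exists m => // n g; apply: opmx_leP => x.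
  rewrite opformZ !opform_gram !gram_compress// !orbit_sum_formal.
  rewrite (_ : \sum_i _ = pi h (\sum_i pi (g i) (V (x i)))); first exact: mP.
  by rewrite raddf_sum; apply: eq_bigr => i _; rewrite piM.
Qed.

Lemma compressD a T b S :
  compress pi V (a *: T + b *: S) = a *: compress pi V T + b *: compress pi V S.
Proof.
apply: funext => g; apply: op_eq_weak => x y.
rewrite compressE opD !opZ hdotDl !hdotZl.
rewrite -[RHS]/(hdot (a *: compress pi V T g x + b *: compress pi V S g x) y).
by rewrite hdotDl !hdotZl !compressE.
Qed.

Lemma commutant_comb a b T S : commutant pi T -> commutant pi S ->
  commutant pi (a *: T + b *: S).
Proof.
move=> cT cS g; apply: op_eq => u.
rewrite !opcompE !opD !opZ linearD !linearZ.
by rewrite -![_ (pi g u)]opcompE cT cS.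
Qed.

Lemma commuteJ_comb a b T S : T *o J = J *o T -> S *o J = J *o S ->
  (a *: T + b *: S) *o J = J *o (a *: T + b *: S).
Proof.
move=> TJ SJ; apply: op_eq => u.
rewrite !opcompE !opD !opZ linearD !linearZ.
by rewrite -![_ (J u)]opcompE TJ SJ.
Qed.

Lemma RN_target_cone a b T S : 0 <= a -> 0 <= b ->
  RN_target pi J T -> RN_target pi J S -> RN_target pi J (a *: T + b *: S).
Proof.
move=> a0 b0 [cT TJ T0] [cS SJ S0]; split.
- exact: commutant_comb.
- exact: commuteJ_comb.
- by move=> u; rewrite opD !opZ hdotDl !hdotZl addr_ge0// mulr_ge0.
Qed.

Lemma udom_gram psi1 psi2 : acp_udom alpha psi1 psi2 ->
  exists2 lambda : R[i], 0 < lambda &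
    forall l, gram psi1 l l <= lambda * gram psi2 l l.
Proof.
move=> [lambda la0 [_ /gram_ge0P pos _ _]]; exists lambda => // l.
by have := pos l; rewrite gramB gramZ subr_ge0.
Qed.

(** lambda phi - phi_T is the compression of lambda - T, which is positive as
    soon as lambda bounds the norm of T. *)
Lemma compress_udom T :
  RN_target pi J T -> acp_udom alpha (compress pi V T) phi.
Proof.
move=> [cT TJ T0]; have [M M0 TM] := operator_bounded T.
exists (M + 1); first by rewrite ltr_wpDl.
rewrite /acp_le.
have -> : (M + 1) *: phi - compress pi V T =
    compress pi V ((M + 1) *: opid K + (-1) *: T).
  by rewrite compressD scaleN1r -phiE.
apply: compress_alphaCP; split.
- by apply: commutant_comb cT; exact: commutant_opid.
- by apply: commuteJ_comb => //; exact: op_eq.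
- move=> u; rewrite opD !opZ hdotDl !hdotZl mulN1r subr_ge0 hdotxx.
  rewrite -[X in X <= _]ger0_norm; last exact: T0.
  rewrite (le_trans (hdot_le _ _))// expr2 mulrA ler_wpM2r//.
  by rewrite (le_trans (TM _))// ler_wpM2r// lerDl.
Qed.

Lemma RN_derivativeE T : RN_target pi J T ->
  RN_derivative pi J V (compress pi V T) = T.
Proof.
move=> tT; rewrite /RN_derivative.
case: xgetP => [S _ [[cS _ _] TS]|/(_ T)]; last by case.
by apply/esym/compress_inj => //; case: tT.
Qed.

(** Compression is onto: this and [RN_derivativeE] make the derivative the
    inverse bijection of T |-> phi_T. *)
Lemma dominatedP psi :
  alphaCP alpha psi /\ acp_udom alpha psi phi <->
  exists2 T, RN_target pi J T & psi = compress pi V T.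
Proof.
split=> [[[psia /gram_ge0P pos _ _] /udom_gram[lambda la0 dom]]|[T tT ->]].
  apply: RN_exists (ltW la0) _ pos dom => g h.
  by have [-> ->] := psia g h.
by split; [exact: compress_alphaCP|exact: compress_udom].
Qed.

(** The forms of the derivatives on orbit sums are those of psi1 and psi2, and
    orbit sums are dense. *)
Lemma RN_derivative_le psi1 psi2 :
  alphaCP alpha psi1 -> alphaCP alpha psi2 ->
  acp_udom alpha psi1 psi2 -> acp_udom alpha psi2 phi ->
  exists2 lambda : R[i], 0 < lambda &
    op_le (RN_derivative pi J V psi1) (lambda *: RN_derivative pi J V psi2).
Proof.
move=> [psia1 /gram_ge0P pos1 _ _] cp2 /udom_gram[la la0 dom1] dom2.
have /dominatedP[T2 t2 E2] := conj cp2 dom2.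
have [mu mu0 dom2'] := udom_gram dom2.
have [||||T1 t1 E1] := @RN_exists psi1 (la * mu).
- by rewrite mulr_ge0// ltW.
- by move=> g h; have [-> ->] := psia1 g h.
- by [].
- by move=> l; rewrite (le_trans (dom1 l))// -mulrA ler_wpM2l// ltW.
exists la => //; rewrite E1 E2 !RN_derivativeE//.
apply: op_ge0_dense orbit_sum_dense _ => _ [l _ <-].
have [cT1 _ _] := t1; have [cT2 _ _] := t2.
rewrite opB opZ hdotBl hdotZl subr_ge0 -!gram_compress//.
by rewrite -E1 -E2.
Qed.

End Stinespring.

Theorem theorem3p6 (R : realType) (G : groupType) (alpha : G -> G)
    (H : hilbertType R) (phi : G -> 'L(H))
    (K : hilbertType R) (J : 'L(K)) (pi : G -> 'L(K)) (V : 'L(H, K)) :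
  involution alpha ->
  alphaCP alpha phi ->
  minimal_stinespring alpha phi pi J V ->
  let Delta := RN_derivative pi J V in
  let dominated := [set psi | alphaCP alpha psi /\ acp_udom alpha psi phi] in
  [/\ affine_on dominated Delta,
      set_bij dominated (RN_target pi J) Delta &
      forall psi1 psi2, alphaCP alpha psi1 -> alphaCP alpha psi2 ->
        acp_udom alpha psi1 psi2 -> acp_udom alpha psi2 phi ->
        exists2 lambda : R[i], 0 < lambda &
          op_le (Delta psi1) (lambda *: Delta psi2)].
Proof.
move=> alphaI _ stine Delta dominated.
have domP psi : dominated psi <->
    exists2 T, RN_target pi J T & psi = compress pi V T.
  exact: dominatedP alphaI stine psi.
have DeltaE T : RN_target pi J T -> Delta (compress pi V T) = T.
  exact: RN_derivativeE alphaI stine T.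
split; last exact: RN_derivative_le alphaI stine.
- move=> t _ _ /andP[t0 t1] /domP[T tT ->] /domP[S tS ->].
  rewrite -compressD !DeltaE//.
    by split=> //; apply/domP; exists (t *: T + (1 - t) *: S) => //;
      apply: RN_target_cone; rewrite ?subr_ge0.
  by apply: RN_target_cone; rewrite ?subr_ge0.
- split.
  + by move=> _ /domP[T tT ->]; rewrite DeltaE.
  + move=> _ _ /set_mem/domP[T tT ->] /set_mem/domP[S tS ->].
    by rewrite !DeltaE// => ->.
  + move=> T tT; exists (compress pi V T); last exact: DeltaE.
    by apply/domP; exists T.
Qed.
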